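(* Let $C$, $c:I\to R_1^4$, be a $2$-degenerate Cartan curve in $R_1^4$, parametrized by its pseudo-arc parameter $s\in I$, and suppose that $C$ is a $(1,2)$-Bertrand curve. Then all four components of $c$ are polynomial functions of $s$ whose third derivative vanishes identically, and at least one of the components is a polynomial of degree two.
   Context: $R_1^4$ is Minkowski spacetime: $\mathbb{R}^4$ with the metric $\langle x,y\rangle=-x^0y^0+x^1y^1+x^2y^2+x^3y^3$. A vector $v$ is null (lightlike) if $v\ne 0$ and $\langle v,v\rangle=0$. Curves are differentiable (smooth) maps defined on an interval $I$, and primes denote derivatives with respect to the parameter. $s$-degenerate curves: for a curve $c:I\to R_1^4$ put $E_i(t)=\mathrm{span}\{c'(t),\dots,c^{(i)}(t)\}$ and $d=\max\{i:\dim E_i(t)=i\text{ for all }t\}$. For a subspace $E$, $\mathrm{Rad}(E)=\{\varepsilon\in E:\langle\varepsilon,v\rangle=0\ \forall v\in E\}$. The curve is $2$-degenerate if $\dim\mathrm{Rad}(E_i(t))$ is constant in $t$ for every $1\le i\le d$, $\mathrm{Rad}(E_2)\neq\{0\}$ and $\mathrm{Rad}(E_1)=\{0\}$. A $2$-degenerate Cartan curve in $R_1^4$ is a $2$-degenerate curve $c$, parametrized by its pseudo-arc parameter $s$, together with a Cartan frame $\{L,N,W_1,W_2\}$ along $c$ and Cartan curvature functions $k_1,k_2$ satisfying the Cartan equations $$c'=W_1,\quad W_1'=L,\quad L'=k_1W_2,\quad W_2'=-k_2L+k_1N,\quad N'=W_1-k_2W_2,$$ where $L,N$ are null, $\langle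 L,N\rangle=-1$, $\{L,N\}$ is orthogonal to $\{W_1,W_2\}$, $\{W_1,W_2\}$ is orthonormal, and $\{L,N,W_1,W_2\}$ is positively oriented. The Cartan $(1,2)$-normal plane of $C$ at $c(s)$ is the plane through $c(s)$ spanned by $W_1(s)$ and $W_2(s)$. A $2$-degenerate Cartan curve $C$ ($c:I\to R_1^4$, pseudo-arc parameter $s$) is a $(1,2)$-Bertrand curve if there exist a $2$-degenerate Cartan curve $\overline C$ ($\overline c:\overline I\to R_1^4$, pseudo-arc parameter $\overline s$), distinct from $C$, and a regular map $\varphi:I\to\overline I$, $\overline s=\varphi(s)$, $\frac{d\varphi(s)}{ds}\neq0$ for all $s\in I$, such that for all $s\in I$ the Cartan $(1,2)$-normal plane of $C$ at $c(s)$ coincides with the Cartan $(1,2)$-normal plane of $\overline C$ at the corresponding point $\overline c(\varphi(s))$. Then $\overline C$ is called a $(1,2)$-Bertrand mate of $C$.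
   Formalization: ''Distinct from C'' is taken to mean that c̄(φ(s)) ≠ c(s) for at least one s in I; otherwise any such curve with k₁ ≠ 0 that extends to a larger interval would have its own extension as a mate, and the claim would fail. *)

(* Defs.v *)
From HB Require Import structures.
From mathcomp Require Import all_boot all_order all_algebra.
From mathcomp Require Import all_classical all_reals all_analysis.

Set Implicit Arguments.
Unset Strict Implicit.
Unset Printing Implicit Defensive.

Import Order.TTheory GRing.Theory Num.Theory.
Import numFieldNormedType.Exports.

Local Open Scope classical_set_scope.
Local Open Scope ring_scope.

(* Calculus on an arbitrary interval [I], which may contain its endpoints: the
   derivative at [t] is the limit of the difference quotient as its argument
   tends to [t] inside [I] (one-sided at an endpoint).  Only values on [I]
   matter. *)
Section CalculusOnInterval.
Variables (R : realType) (V : normedModType R).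
Implicit Types (I : set R) (f : R -> V).

Definition diff_quotient f (t u : R) : V := (u - t)^-1 *: (f u - f t).

Definition derivable_in I f (t : R) : Prop :=
  cvg (diff_quotient f t @ within I t^').

Definition derive_in I f (t : R) : V :=
  lim (diff_quotient f t @ within I t^').

Definition derive_in_n I (n : nat) f : R -> V := iter n (derive_in I) f.

Definition smooth_in I f : Prop :=
  forall (n : nat) (t : R), I t -> derivable_in I (derive_in_n I n f) t.

End CalculusOnInterval.

Section Minkowski.
Variable R : realType.

Definition minkowski_mx : 'M[R]_4 :=
  diag_mx (\row_(i < 4) (if i == ord0 then -1 else 1)).

Definition mdot (x y : 'rV[R]_4) : R := (x *m minkowski_mx *m y^T) ord0 ord0.

Definition null_vector (v : 'rV[R]_4) : Prop := v != 0 /\ mdot v v = 0.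

(* A subspace is represented by a matrix whose row space it is; the kernel below
   consists of the vectors that are orthogonal to every row of [E]. *)
Definition radical_mx (m : nat) (E : 'M[R]_(m, 4)) : 'M[R]_4 :=
  (E :&: kermx (minkowski_mx *m E^T))%MS.

Definition frame_mx (v0 v1 v2 v3 : 'rV[R]_4) : 'M[R]_4 :=
  \matrix_(i < 4) [:: v0; v1; v2; v3]`_i.

End Minkowski.

Section Degenerate.
Variables (R : realType) (I : set R) (c : R -> 'rV[R]_4).

(* The rows are c'(t), ..., c^(i)(t), so the row space is E_i(t). *)
Definition osculating_mx (i : nat) (t : R) : 'M[R]_(i, 4) :=
  \matrix_(j < i) derive_in_n I j.+1 c t.

Definition osculating_dim_is (i : nat) : Prop :=
  forall t, I t -> \rank (osculating_mx i t) = i.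

Definition osculating_order (d : nat) : Prop :=
  osculating_dim_is d /\ (forall i, osculating_dim_is i -> (i <= d)%N).

Definition two_degenerate : Prop :=
  exists d : nat,
    [/\ osculating_order d,
        forall i, (1 <= i <= d)%N -> forall t u, I t -> I u ->
          \rank (radical_mx (osculating_mx i t)) =
          \rank (radical_mx (osculating_mx i u)),
        forall t, I t -> radical_mx (osculating_mx 2%N t) != 0
      & forall t, I t -> radical_mx (osculating_mx 1%N t) = 0].

End Degenerate.

(* That the parameter is the pseudo-arc parameter is expressed by the first two
   Cartan equations, c' = W1 with W1 a unit vector and c'' = L. *)
Record cartanCurve (R : realType) := CartanCurve {
  cdom : set R;
  ccurve : R -> 'rV[R]_4;
  cL : R -> 'rV[R]_4;
  cN : R -> 'rV[R]_4;
  cW1 : R -> 'rV[R]_4;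
  cW2 : R -> 'rV[R]_4;
  ck1 : R -> R;
  ck2 : R -> R;
  cdom_interval : is_interval cdom;
  cdom_nondegenerate : exists a b, [/\ cdom a, cdom b & a < b];
  ccurve_smooth : smooth_in cdom ccurve;
  cframe_smooth : [/\ smooth_in cdom cL, smooth_in cdom cN,
                      smooth_in cdom cW1 & smooth_in cdom cW2];
  ccurvature_smooth : @smooth_in R R^o cdom ck1 /\ @smooth_in R R^o cdom ck2;
  ccurve_two_degenerate : two_degenerate cdom ccurve;
  cLN_null : forall s, cdom s -> null_vector (cL s) /\ null_vector (cN s);
  cLN_dot : forall s, cdom s -> mdot (cL s) (cN s) = -1;
  cLN_orthogonal : forall s, cdom s ->
    [/\ mdot (cL s) (cW1 s) = 0, mdot (cL s) (cW2 s) = 0,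
        mdot (cN s) (cW1 s) = 0 & mdot (cN s) (cW2 s) = 0];
  cW_orthonormal : forall s, cdom s ->
    [/\ mdot (cW1 s) (cW1 s) = 1, mdot (cW2 s) (cW2 s) = 1
      & mdot (cW1 s) (cW2 s) = 0];
  cframe_positive : forall s, cdom s ->
    0 < \det (frame_mx (cL s) (cN s) (cW1 s) (cW2 s));
  cartan_equations : forall s, cdom s ->
    [/\ derive_in cdom ccurve s = cW1 s,
        derive_in cdom cW1 s = cL s,
        derive_in cdom cL s = ck1 s *: cW2 s,
        derive_in cdom cW2 s = - ck2 s *: cL s + ck1 s *: cN s
      & derive_in cdom cN s = cW1 s - ck2 s *: cW2 s]
}.

Section Bertrand.
Variable R : realType.
Implicit Types C D : cartanCurve R.

Definition cartan12_normal_plane C (s : R) : set 'rV[R]_4 :=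
  [set x | exists a b : R, x = ccurve C s + a *: cW1 C s + b *: cW2 C s].

(* [D] is distinct from [C] when the correspondence does not match every point
   of [C] with itself.  Comparing only the maps or their images instead
   would make a proper extension of [C] to a larger interval a mate of [C]. *)
Definition bertrand12_mate C D : Prop :=
  exists phi : R -> R,
    [/\ forall s, cdom C s -> cdom D (phi s),
        @smooth_in R R^o (cdom C) phi,
        forall s, cdom C s -> @derive_in R R^o (cdom C) phi s != 0,
        exists2 s, cdom C s & ccurve D (phi s) != ccurve C s
      & forall s, cdom C s ->
          cartan12_normal_plane C s = cartan12_normal_plane D (phi s)].

Definition bertrand12 C : Prop := exists D, bertrand12_mate C D.

End Bertrand.

(* Main.v *)
Require Import Defs.
From HB Require Import structures.
From mathcomp Require Import all_boot all_order all_algebra.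
From mathcomp Require Import all_classical all_reals all_analysis.
From mathcomp Require Import ring lra.

Import Order.TTheory GRing.Theory Num.Theory.
Import numFieldNormedType.Exports.
Local Open Scope classical_set_scope.
Local Open Scope ring_scope.

(* Let [delta s = cbar (phi s) - c s = a W1 + b W2] join corresponding points, and
   let [y = <W1bar o phi, W2>].  Since [W1bar] lies in the span of [W1] and [W2],
   differentiating [<delta, L> = <delta, N> = 0] gives [k1 b = 0] and [a = k2 b],
   and differentiating [b] and [y] gives [b' = phi' y] and [y' = 0].  If [k1] is
   nonzero somewhere, then [b], hence [a] and [delta], vanish identically and the
   two curves coincide.  So [k1 = 0], that is [L' = 0], while [c'' = L] is
   nonzero. *)

Set Implicit Arguments.
Unset Strict Implicit.

(* Caratheodory's form of the derivative, in which the chain rule needs no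
   condition on the values of the inner function. *)
Definition has_slope (R : realType) (I : set R) (f : R -> R) (t l : R) : Prop :=
  exists q : R -> R, (forall u, I u -> f u = f t + (u - t) * q u) /\
    (q u @[u --> within I (nbhs t)] --> l).

(** Taken coordinatewise, so that the product rule for [mdot] reduces to that for real functions. *)
Definition has_vslope (R : realType) (I : set R) (f : R -> 'rV[R]_4) (t : R)
    (l : 'rV[R]_4) : Prop :=
  forall i, has_slope I (fun u => f u ord0 i) t (l ord0 i).

(** * Calculus of slopes on an interval *)

Section Slopes.
Variables (R : realType).
Implicit Types (I J : set R) (f g : R -> R) (t l m : R).

Lemma smooth_derivable_in (V : normedModType R) I (f : R -> V) t :
  smooth_in I f -> I t -> derivable_in I f t.
Proof. by move=> fs It; exact: (fs 0%N t It). Qed.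

Lemma diff_quotient_slope (V : normedModType R) I (f : R -> V) t (l : V) :
  derivable_in I f t -> derive_in I f t = l ->
  exists q : R -> V, (forall u, I u -> f u = f t + (u - t) *: q u) /\
    (q u @[u --> within I (nbhs t)] --> l).
Proof.
rewrite /derivable_in /derive_in => df lE; rewrite lE in df.
(* Filling in the value [l] at [t] turns the limit over the punctured neighbourhood into one over
   the full neighbourhood. *)
exists (fun u => if u == t then l else diff_quotient f t u); split.
  move=> u _; have [->|neq_ut] := eqVneq u t; first by rewrite subrr scale0r addr0.
  by rewrite /diff_quotient scalerA divff ?subr_eq0// scale1r addrC subrK.
move=> A Al.
have : \forall u \near t, u != t -> I u -> A (diff_quotient f t u) := df A Al.
suff : (\forall u \near t, u != t -> I u -> A (diff_quotient f t u)) ->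
  \forall u \near t, I u -> A (if u == t then l else diff_quotient f t u) by [].
apply: filterS => u Hu Iu.
have [_|neq_ut] := eqVneq u t; first exact: nbhs_singleton.
exact: Hu.
Qed.

Lemma derive_in_slope I (f : R -> R^o) t (l : R) :
  derivable_in I f t -> derive_in I f t = l -> has_slope I f t l.
Proof.
by move=> df lE; have [q [fq ql]] := @diff_quotient_slope R^o I f t l df lE; exists q.
Qed.

Lemma derive_in_vslope I (f : R -> 'rV[R]_4) t (l : 'rV[R]_4) :
  derivable_in I f t -> derive_in I f t = l -> has_vslope I f t l.
Proof.
move=> df lE i; have [q [fq ql]] := diff_quotient_slope df lE.
exists (fun u => q u ord0 i); split; first by move=> u /fq ->; rewrite !mxE.
exact: (cvg_comp _ _ ql (@coord_continuous _ _ _ ord0 i l)).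
Qed.

Lemma slope_continuous I f t l : has_slope I f t l ->
  f u @[u --> within I (nbhs t)] --> f t.
Proof.
move=> [q [fq ql]].
have idt : (fun u : R => u) u @[u --> within I (nbhs t)] --> t by exact: cvg_within.
have : f t + (u - t) * q u @[u --> within I (nbhs t)] --> f t + (t - t) * l.
  apply: cvgD; first exact: cvg_cst.
  by apply: cvgM => //; apply: cvgB => //; exact: cvg_cst.
rewrite subrr mul0r addr0; apply: cvg_trans; apply: near_eq_cvg.
by rewrite near_withinE; apply: nearW => u /fq.
Qed.

Lemma slope_cst I (a t : R) : has_slope I (fun=> a) t 0.
Proof.
exists (fun=> 0); split; last exact: cvg_cst.
by move=> u _; rewrite mulr0 addr0.
Qed.

Lemma slope_id I t : has_slope I id t 1.
Proof.
exists (fun=> 1); split; last exact: cvg_cst.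
by move=> u _; rewrite mulr1 addrC subrK.
Qed.

Lemma slopeD I f g t l m : has_slope I f t l -> has_slope I g t m ->
  has_slope I (fun u => f u + g u) t (l + m).
Proof.
move=> [q [fq ql]] [r [gr rm]]; exists (fun u => q u + r u); split.
  by move=> u Iu; rewrite (fq u Iu) (gr u Iu); ring.
exact: cvgD.
Qed.

Lemma slopeM I f g t l m : has_slope I f t l -> has_slope I g t m ->
  has_slope I (fun u => f u * g u) t (l * g t + f t * m).
Proof.
move=> fl gm; have gc := slope_continuous gm.
case: fl gm => [q [fq ql]] [r [gr rm]].
(* From [f u * g u - f t * g t = (f u - f t) * g u + f t * (g u - g t)]; the factor [g u] is why
   continuity of [g] is needed. *)
exists (fun u => q u * g u + f t * r u); split.
  by move=> u Iu; rewrite (fq u Iu) (gr u Iu); ring.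
by apply: cvgD; apply: cvgM => //; exact: cvg_cst.
Qed.

Lemma slopeB I f g t l m : has_slope I f t l -> has_slope I g t m ->
  has_slope I (fun u => f u - g u) t (l - m).
Proof.
move=> [q [fq ql]] [r [gr rm]]; exists (fun u => q u - r u); split.
  by move=> u Iu; rewrite (fq u Iu) (gr u Iu); ring.
exact: cvgB.
Qed.

Lemma slope_comp I J f g t l m : (forall u, I u -> J (g u)) ->
  has_slope J f (g t) l -> has_slope I g t m ->
  has_slope I (fun u => f (g u)) t (m * l).
Proof.
move=> IJ [q [fq ql]] gm; have gc := slope_continuous gm.
(* Since [q] is also defined at [g t], the case [g u = g t] needs no separate treatment. *)
case: gm => [r [gr rm]]; exists (fun u => r u * q (g u)); split.
  by move=> u Iu; rewrite (fq _ (IJ u Iu)) {1}(gr u Iu); ring.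
apply: cvgM => //; apply: (cvg_comp g q _ ql) => A At.
have : \forall u \near t, I u -> J (g u) -> A (g u) := gc _ At.
suff : (\forall u \near t, I u -> J (g u) -> A (g u)) ->
  \forall u \near t, I u -> A (g u) by [].
by apply: filterS => u Au Iu; apply: Au => //; exact: IJ.
Qed.

Lemma slope_eq I f g t l : (forall u, I u -> f u = g u) -> I t ->
  has_slope I f t l -> has_slope I g t l.
Proof.
by move=> fg It [q [fq ql]]; exists q; split => // u Iu; rewrite -!fg// fq.
Qed.

(* The interval must be nondegenerate: on a single point every number is a slope. *)
Lemma slope_eq0 I f t l : is_interval I -> (exists a b, [/\ I a, I b & a < b]) ->
  I t -> (forall u, I u -> f u = 0) -> has_slope I f t l -> l = 0.
Proof.
move=> Ii [a [b [Ia Ib ab]]] It f0 [q [fq ql]].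
apply/eqP/negP => /negP l0.
have [v Iv nvt] : exists2 v, I v & v != t.
  have [->|nat] := eqVneq t a; first by exists b => //; rewrite gt_eqF.
  by exists a => //; rewrite eq_sym.
(* It remains to find a point [u != t] of [I] this close to [t]: there [0 = (u - t) * q u] is
   contradictory. *)
have : \forall u \near within I (nbhs t), q u != 0.
  exact: (@cvgr_neq0 R R^o R _ _ q l ql l0).
rewrite near_withinE => /nbhs_ballP [e /= e0 He].
(* The bound 1 keeps [u] between [t] and [v], hence in [I]; the other bound puts [u] within [e / 2]
   of [t]. *)
pose k := Num.min 1 (e / (2 * `|v - t|)).
have vt0 : 0 < `|v - t| by rewrite normr_gt0 subr_eq0.
have k0 : 0 < k by rewrite lt_min ltr01 divr_gt0// mulr_gt0.
have k1 : k <= 1 by rewrite ge_min lexx.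
have ke : k * `|v - t| < e.
  have : k <= e / (2 * `|v - t|) by rewrite ge_min lexx orbT.
  rewrite ler_pdivlMr ?mulr_gt0// => h.
  by have : 0 < k * `|v - t| by [rewrite mulr_gt0|]; lra.
pose u := t + k * (v - t).
have Iu : I u.
  case/orP: (real_leVge (num_real t) (num_real v)) => h.
    by apply: (Ii t v) => //; rewrite /u; apply/andP; split; nra.
  by apply: (Ii v t) => //; rewrite /u; apply/andP; split; nra.
have ut : u - t != 0.
  by rewrite /u addrC addKr mulf_neq0 ?subr_eq0// gt_eqF.
have := He u; rewrite /ball /= opprD addrA subrr sub0r normrN normrM gtr0_norm//.
move=> /(_ ke Iu) /negP; apply.
by have := fq u Iu; rewrite !f0// add0r => /esym/eqP; rewrite mulf_eq0 (negPf ut).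
Qed.

(** The points [x] and [y] make [t] interior to [I], so restricting to [I] does not affect the
    limit. This is the bridge to the two-sided derivative in the mean value theorem. *)
Lemma slope_is_derive I f t l (x y : R) : is_interval I -> I x -> I y ->
  x < t -> t < y -> has_slope I f t l -> is_derive t 1 f l.
Proof.
move=> Ii Ix Iy xt ty [q [fq ql]].
have It : I t by apply: (Ii x y) => //; rewrite !ltW.
have shift0 : (h + t) @[h --> (0 : R)^'] --> t.
  rewrite -[X in _ --> X]add0r; apply: cvgD; last exact: cvg_cst.
  exact: nbhs_dnbhs.
have Inear : \forall h \near (0 : R)^', I (h + t).
  apply: (shift0 [set u | I u]).
  have : \forall u \near t, x < u < y.
    by near=> u; apply/andP; split; near: u; [exact: lt_nbhsr|exact: lt_nbhsl].
  by apply: filterS => u /= /andP[xu uy]; apply: (Ii x y) => //; rewrite !ltW.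
have H : (fun h => h^-1 *: ((f \o shift t) (h *: (1 : R)) - f t)) @ (0 : R)^' --> l.
  apply: (@cvg_trans _ ((fun h => q (h + t)) @ (0:R)^')).
    apply: near_eq_cvg; near=> h.
    have h0 : h != 0 by near: h; exact: nbhs_dnbhs_neq.
    rewrite /= /GRing.scale /= mulr1 (fq (h + t)); last by near: h.
    by field.
  apply: (cvg_comp (fun h => h + t) q _ ql) => A.
  move=> At; have At' : \forall h \near (0 : R)^', I (h + t) -> A (h + t).
    exact: (shift0 [set u | I u -> A u]).
  by apply: filterS2 Inear At' => h Ih; apply.
split; first by apply/cvg_ex; exists l.
exact: cvg_lim.
Unshelve. all: by end_near. Qed.

(** Mean value theorem on the segment from [s] to [t]. Its ends may be endpoints of [I], but only
    continuity is asked there, and one-sided slopes give it. *)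
Lemma slope0_constant I f : is_interval I ->
  (forall t, I t -> has_slope I f t 0) -> forall s t, I s -> I t -> f s = f t.
Proof.
move=> Ii f0 s t Is It.
wlog st : s t Is It / s < t.
  move=> H; case: (ltgtP s t) => [|/H ->//|->//]; exact: H.
have sub : `[s, t] `<=` I by move=> u /=; rewrite in_itv /=; exact: Ii.
have [] := @MVT _ f (fun=> 0) s t st.
- move=> x; rewrite in_itv /= => /andP[sx xt].
  apply: (slope_is_derive Ii Is It sx xt); apply: f0.
  by apply: (Ii s t) => //; rewrite !ltW.
- apply/subspace_continuousP => x xst.
  have := slope_continuous (f0 _ (sub _ xst)); apply: cvg_trans => A.
  suff : (\forall u \near x, I u -> A (f u)) ->
    \forall u \near x, u \in `[s, t] -> A (f u) by [].
  by apply: filterS => u Au ust; apply: Au; exact: sub.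
by move=> c _ /eqP; rewrite mul0r subr_eq0 => /eqP.
Qed.

End Slopes.

(** * The Minkowski product and its product rule *)

Section MinkowskiDot.
Variable R : realType.
Implicit Types (I : set R) (x y z : 'rV[R]_4) (a : R).

Lemma mdotE x y : mdot x y = - (x ord0 0 * y ord0 0) + x ord0 1 * y ord0 1 +
  x ord0 2%:R * y ord0 2%:R + x ord0 3%:R * y ord0 3%:R.
Proof.
rewrite /mdot mxE !big_ord_recr big_ord0 /= add0r mul_mx_diag !mxE /=.
rewrite mulrN1 mulNr !mulr1.
(* The two sides write the same four indices as different ordinals of equal value. *)
by congr (- (x _ _ * y _ _) + x _ _ * y _ _ + x _ _ * y _ _ + x _ _ * y _ _);
  apply/val_inj.
Qed.

Lemma mdotC x y : mdot x y = mdot y x.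
Proof. by rewrite !mdotE; ring. Qed.

Lemma mdotDl x y z : mdot (x + y) z = mdot x z + mdot y z.
Proof. by rewrite !mdotE !mxE; ring. Qed.

Lemma mdotZl a x y : mdot (a *: x) y = a * mdot x y.
Proof. by rewrite !mdotE !mxE; ring. Qed.

Lemma mdotDr x y z : mdot z (x + y) = mdot z x + mdot z y.
Proof. by rewrite !(mdotC z) mdotDl. Qed.

Lemma mdotZr a x y : mdot y (a *: x) = a * mdot y x.
Proof. by rewrite !(mdotC y) mdotZl. Qed.

Lemma mdotBl x y z : mdot (x - y) z = mdot x z - mdot y z.
Proof. by rewrite -scaleN1r mdotDl mdotZl mulN1r. Qed.

Lemma mdotBr x y z : mdot z (x - y) = mdot z x - mdot z y.
Proof. by rewrite !(mdotC z) mdotBl. Qed.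

Lemma slope_mdot I (f g : R -> 'rV[R]_4) (t : R) x y :
  has_vslope I f t x -> has_vslope I g t y ->
  has_slope I (fun u => mdot (f u) (g u)) t (mdot x (g t) + mdot (f t) y).
Proof.
move=> fx gy.
have fg i := slopeM (fx i) (gy i).
(* The time coordinate carries the minus sign, so its product is subtracted from that of the first
   space coordinate. *)
have := slopeD (slopeD (slopeB (fg 1) (fg 0)) (fg 2%:R)) (fg 3%:R).
rewrite (_ : (fun u => mdot (f u) (g u)) = fun u => f u ord0 1 * g u ord0 1 -
  f u ord0 0 * g u ord0 0 + f u ord0 2%:R * g u ord0 2%:R +
  f u ord0 3%:R * g u ord0 3%:R); last first.
  by apply/funext => u; rewrite mdotE; ring.
by congr has_slope; rewrite !mdotE; ring.
Qed.

Lemma vslopeB I (f g : R -> 'rV[R]_4) (t : R) x y :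
  has_vslope I f t x -> has_vslope I g t y ->
  has_vslope I (fun u => f u - g u) t (x - y).
Proof.
move=> fx gy i; rewrite !mxE.
rewrite (_ : (fun u => _) = fun u => f u ord0 i - g u ord0 i); last first.
  by apply/funext => u; rewrite !mxE.
exact: slopeB.
Qed.

Lemma vslope_comp I J (f : R -> 'rV[R]_4) (g : R -> R) (t m : R) x :
  (forall u, I u -> J (g u)) ->
  has_vslope J f (g t) x -> has_slope I g t m ->
  has_vslope I (fun u => f (g u)) t (m *: x).
Proof.
by move=> IJ fx gm i; rewrite mxE; exact: (slope_comp (f := fun v => f v ord0 i) IJ).
Qed.

End MinkowskiDot.

(** * Cartan equations and coordinates in the normal plane *)

Section CartanCurves.
Variable R : realType.
Implicit Types C D : cartanCurve R.

Lemma cartan_slopes C s : cdom C s ->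
  [/\ has_vslope (cdom C) (ccurve C) s (cW1 C s),
      has_vslope (cdom C) (cW1 C) s (cL C s),
      has_vslope (cdom C) (cL C) s (ck1 C s *: cW2 C s),
      has_vslope (cdom C) (cW2 C) s (- ck2 C s *: cL C s + ck1 C s *: cN C s)
    & has_vslope (cdom C) (cN C) s (cW1 C s - ck2 C s *: cW2 C s)].
Proof.
move=> Is; have [c' W1' L' W2' N'] := cartan_equations Is.
have [Ls Ns W1s W2s] := cframe_smooth C.
split.
- exact: derive_in_vslope (smooth_derivable_in (ccurve_smooth (c := C)) Is) c'.
- exact: derive_in_vslope (smooth_derivable_in W1s Is) W1'.
- exact: derive_in_vslope (smooth_derivable_in Ls Is) L'.
- exact: derive_in_vslope (smooth_derivable_in W2s Is) W2'.
- exact: derive_in_vslope (smooth_derivable_in Ns Is) N'.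
Qed.

(** Orthonormality of [cW1] and [cW2] replaces the existential coefficients by inner products, which
    can be differentiated along the curve. *)
Lemma normal_plane_dot C s x : cdom C s -> cartan12_normal_plane C s x ->
  x - ccurve C s = mdot (x - ccurve C s) (cW1 C s) *: cW1 C s +
                   mdot (x - ccurve C s) (cW2 C s) *: cW2 C s.
Proof.
move=> Is [a [b ->]]; have [W11 W22 W12] := cW_orthonormal Is.
have -> : ccurve C s + a *: cW1 C s + b *: cW2 C s - ccurve C s =
    a *: cW1 C s + b *: cW2 C s.
  by apply/rowP => i; rewrite !mxE; ring.
rewrite !mdotDl !mdotZl W11 W22 W12 (mdotC (cW2 C s)) W12.
by rewrite !mulr0 !mulr1 addr0 add0r.
Qed.

(** * Two Cartan curves with common normal planes *)

Section SharedPlanes.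
Variables (C D : cartanCurve R) (phi : R -> R).
Local Notation I := (cdom C).
Hypothesis phiI : forall s, I s -> cdom D (phi s).
Hypothesis phi_smooth : @smooth_in R R^o I phi.
Hypothesis phi'_neq0 : forall s, I s -> @derive_in R R^o I phi s != 0.
Hypothesis planeE : forall s, I s ->
  cartan12_normal_plane C s = cartan12_normal_plane D (phi s).

Let phi' s := @derive_in R R^o I phi s.
Let delta s := ccurve D (phi s) - ccurve C s.
Let a s := mdot (delta s) (cW1 C s).
Let b s := mdot (delta s) (cW2 C s).
Let y s := mdot (cW1 D (phi s)) (cW2 C s).

Let in_planeD s u v : I s ->
  cartan12_normal_plane C s
    (ccurve D (phi s) + u *: cW1 D (phi s) + v *: cW2 D (phi s)).
Proof. by move=> Is; rewrite planeE//; exists u, v. Qed.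

Let deltaE s : I s -> delta s = a s *: cW1 C s + b s *: cW2 C s.
Proof.
move=> Is; apply: normal_plane_dot => //.
by have := in_planeD 0 0 Is; rewrite !scale0r !addr0.
Qed.

(** Equal affine planes have equal directions: the vector is the difference of two points of the
    common plane, both written in the frame of [C]. *)
Let dir_span s u v : I s -> exists p q,
  u *: cW1 D (phi s) + v *: cW2 D (phi s) = p *: cW1 C s + q *: cW2 C s.
Proof.
move=> Is; have [p [q pq]] := in_planeD u v Is.
have := deltaE Is; rewrite /delta => dE.
exists (p - a s), (q - b s).
have -> : u *: cW1 D (phi s) + v *: cW2 D (phi s) =
  (ccurve D (phi s) + u *: cW1 D (phi s) + v *: cW2 D (phi s)) - ccurve C s -
  (ccurve D (phi s) - ccurve C s).
  by apply/rowP => i; rewrite !mxE; ring.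
by rewrite pq dE; apply/rowP => i; rewrite !mxE; ring.
Qed.

Let W2_span s : I s -> exists p q,
  cW2 C s = p *: cW1 D (phi s) + q *: cW2 D (phi s).
Proof.
move=> Is.
have H u v : cartan12_normal_plane D (phi s)
    (ccurve C s + u *: cW1 C s + v *: cW2 C s).
  by rewrite -planeE//; exists u, v.
have [p [q pq]] := H 0 1; have [p' [q' pq']] := H 0 0.
exists (p - p'), (q - q').
have -> : cW2 C s = (ccurve C s + 0 *: cW1 C s + 1 *: cW2 C s) -
  (ccurve C s + 0 *: cW1 C s + 0 *: cW2 C s).
  by apply/rowP => i; rewrite !mxE; ring.
by rewrite pq pq'; apply/rowP => i; rewrite !mxE; ring.
Qed.

Let W1D_orth s : I s ->
  mdot (cW1 D (phi s)) (cL C s) = 0 /\ mdot (cW1 D (phi s)) (cN C s) = 0.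
Proof.
move=> Is; have [LW1 LW2 NW1 NW2] := cLN_orthogonal Is.
have [p [q]] := dir_span 1 0 Is; rewrite scale1r scale0r addr0 => ->.
by rewrite !(mdotC (_ + _)) !mdotDr !mdotZr LW1 LW2 NW1 NW2 !mulr0 !addr0.
Qed.

(** Here the inclusion of directions is used the other way: [cW2 C s] lies in the span of [cW1 D]
    and [cW2 D], to which [cL D] is orthogonal. *)
Let LD_orth s : I s -> mdot (cL D (phi s)) (cW2 C s) = 0.
Proof.
move=> Is; have [LW1 LW2 NW1 NW2] := cLN_orthogonal (phiI Is).
have [p [q ->]] := W2_span Is.
by rewrite !mdotDr !mdotZr LW1 LW2 !mulr0 addr0.
Qed.

Let phi_slope s : I s -> has_slope I phi s (phi' s).
Proof. by move=> Is; exact: derive_in_slope (smooth_derivable_in phi_smooth Is) erefl. Qed.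

Let delta_slope s : I s ->
  has_vslope I delta s (phi' s *: cW1 D (phi s) - cW1 C s).
Proof.
move=> Is; have [c' _ _ _ _] := cartan_slopes Is.
have [d' _ _ _ _] := cartan_slopes (phiI Is).
exact: vslopeB (vslope_comp phiI d' (phi_slope Is)) c'.
Qed.

Let delta_orth s : I s -> mdot (delta s) (cL C s) = 0 /\ mdot (delta s) (cN C s) = 0.
Proof.
move=> Is; have [LW1 LW2 NW1 NW2] := cLN_orthogonal Is.
rewrite deltaE// !(mdotC (_ + _)) !mdotDr !mdotZr LW1 LW2 NW1 NW2.
by rewrite !mulr0 !addr0.
Qed.

(** The derivative of [cW2 C] is a combination of [cL C] and [cN C], both orthogonal to [delta], so
    only the derivative of [delta] contributes. *)
Let slope_b s : I s -> has_slope I b s (phi' s * y s).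
Proof.
move=> Is; have [_ _ _ W2' _] := cartan_slopes Is.
have := slope_mdot (delta_slope Is) W2'.
have [W11 W22 W12] := cW_orthonormal Is; have [dL dN] := delta_orth Is.
by rewrite mdotDr !mdotZr dL dN mdotBl mdotZl W12 !mulr0 !addr0 subr0.
Qed.

(** Both terms of the product rule vanish: [cL D] is orthogonal to [cW2 C], and [cW1 D] is
    orthogonal to [cL C] and [cN C]. *)
Let slope_y s : I s -> has_slope I y s 0.
Proof.
move=> Is; have [_ _ _ W2' _] := cartan_slopes Is.
have [_ W1' _ _ _] := cartan_slopes (phiI Is).
have := slope_mdot (vslope_comp phiI W1' (phi_slope Is)) W2'.
have [oL oN] := W1D_orth Is.
by rewrite mdotDr !mdotZr oL oN mdotZl LD_orth// !mulr0 !addr0.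
Qed.

Let k1b s : I s -> ck1 C s * b s = 0.
Proof.
move=> Is; have [_ _ L' _ _] := cartan_slopes Is.
have [oL _] := W1D_orth Is; have [LW1 _ _ _] := cLN_orthogonal Is.
(* The derivative of [delta] is orthogonal to [cL C], so the slope of the zero function
   [mdot delta cL] is [ck1 * b]. *)
have := slope_mdot (delta_slope Is) L'.
rewrite mdotBl mdotZl oL (mdotC (cW1 C s)) LW1 mulr0 subr0 add0r mdotZr.
apply: slope_eq0 => //; first exact: cdom_interval; first exact: cdom_nondegenerate.
by move=> u Iu; case: (delta_orth Iu).
Qed.

Let a_k2b s : I s -> a s = ck2 C s * b s.
Proof.
move=> Is; have [_ _ _ _ N'] := cartan_slopes Is.
have [_ oN] := W1D_orth Is; have [_ _ NW1 _] := cLN_orthogonal Is.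
(* Likewise the slope of the zero function [mdot delta cN] is [a - ck2 * b]. *)
have := slope_mdot (delta_slope Is) N'.
rewrite mdotBl mdotZl oN (mdotC (cW1 C s)) NW1 mulr0 subr0 add0r mdotBr mdotZr.
move=> H; apply/eqP; rewrite -subr_eq0; apply/eqP; move: H.
apply: slope_eq0 => //; first exact: cdom_interval; first exact: cdom_nondegenerate.
by move=> u Iu; case: (delta_orth Iu).
Qed.

(* Where [k1] does not vanish, [b] and [b'] do, so the constant [y] is zero and
   [b' = phi' y] vanishes on all of [I]. *)
Lemma shared_planes_curve_eq s0 s : I s0 -> ck1 C s0 != 0 -> I s ->
  ccurve D (phi s) = ccurve C s.
Proof.
move=> Is0 k0 Is; have Ii := cdom_interval (c := C).
have b0 : b s0 = 0.
  by apply/eqP; have /eqP := k1b Is0; rewrite mulf_eq0 (negPf k0).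
have y0 : y s0 = 0.
  have k1' : has_slope I (ck1 C) s0 (@derive_in R R^o I (ck1 C) s0).
    have [k1s _] := ccurvature_smooth C.
    exact: derive_in_slope (smooth_derivable_in k1s Is0) erefl.
  (* Differentiating [ck1 * b = 0] at [s0], where [b] vanishes, leaves [ck1 * (phi' * y) = 0]. *)
  have := slope_eq0 Ii (cdom_nondegenerate C) Is0 k1b (slopeM k1' (slope_b Is0)).
  rewrite b0 mulr0 add0r => /eqP.
  by rewrite !mulf_eq0 (negPf k0) (negPf (phi'_neq0 Is0)) => /eqP.
have yE u : I u -> y u = 0.
  by move=> Iu; rewrite -y0; exact: (slope0_constant Ii slope_y).
have bE : b s = 0.
  rewrite -b0; apply: (slope0_constant Ii) Is Is0 => u Iu.
  by have := slope_b Iu; rewrite yE// mulr0.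
apply/eqP; rewrite -subr_eq0; apply/eqP; rewrite -/(delta s) deltaE// a_k2b// bE.
by rewrite mulr0 !scale0r addr0.
Qed.

End SharedPlanes.

(** * Vanishing of the first curvature and integration of the Cartan equations *)

Lemma bertrand12_k1_eq0 C s : bertrand12 C -> cdom C s -> ck1 C s = 0.
Proof.
move=> [D [phi [phiI phis phi' [u Iu neq] planeE]]] Is.
(* A nonzero [ck1] at the single point [s] would make the curves agree on all of [I], in particular
   at [u]. *)
apply/eqP; apply: contraNT neq => k1.
by rewrite (shared_planes_curve_eq phiI phis phi' planeE Is k1 Iu).
Qed.

(** Integrate [L' = 0], [W1' = L] and [c' = W1] in turn: each function minus the expected
    antiderivative has slope zero, hence equals its value at [s0]. *)
Lemma k1_eq0_quadratic C s0 : cdom C s0 -> (forall s, cdom C s -> ck1 C s = 0) ->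
  forall i s, cdom C s -> ccurve C s ord0 i = ccurve C s0 ord0 i +
    cW1 C s0 ord0 i * (s - s0) + cL C s0 ord0 i / 2 * (s - s0) ^+ 2.
Proof.
move=> Is0 k10 i.
have Ii := cdom_interval (c := C).
have LE s : cdom C s -> cL C s ord0 i = cL C s0 ord0 i.
  move=> Is; apply: (slope0_constant (f := fun u => cL C u ord0 i) Ii) Is Is0.
  move=> u Iu; have [_ _ L' _ _] := cartan_slopes Iu.
  by have := L' i; rewrite k10// scale0r mxE.
have shift_slope s : has_slope (cdom C) (fun u => u - s0) s 1.
  by rewrite -[X in has_slope _ _ _ X]subr0; apply: slopeB (slope_id _ _) (slope_cst _ _ _).
have W1E s : cdom C s -> cW1 C s ord0 i = cW1 C s0 ord0 i + cL C s0 ord0 i * (s - s0).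
  move=> Is.
  have := slope0_constant
    (f := fun u => cW1 C u ord0 i - cL C s0 ord0 i * (u - s0)) Ii _ Is Is0.
  rewrite subrr mulr0 subr0 => <-; first by rewrite subrK.
  move=> u Iu; have [_ W1' _ _ _] := cartan_slopes Iu.
  have := slopeB (W1' i) (slopeM (slope_cst _ (cL C s0 ord0 i) _) (shift_slope u)).
  by congr has_slope; rewrite LE//; ring.
move=> s Is.
have := slope0_constant (f := fun u => ccurve C u ord0 i -
  (cW1 C s0 ord0 i * (u - s0) + cL C s0 ord0 i / 2 * ((u - s0) * (u - s0)))) Ii _ Is Is0.
rewrite subrr !mulr0 addr0 subr0 => <-; first by ring.
move=> u Iu; have [c' _ _ _ _] := cartan_slopes Iu.
have := slopeB (c' i) (slopeD
  (slopeM (slope_cst _ (cW1 C s0 ord0 i) _) (shift_slope u))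
  (slopeM (slope_cst _ (cL C s0 ord0 i / 2) _)
    (slopeM (shift_slope u) (shift_slope u)))).
by congr has_slope; rewrite W1E//; field.
Qed.

End CartanCurves.

(** * The component polynomials and their degrees *)

Unset Implicit Arguments.
Set Strict Implicit.

Theorem mainTheorem2 (R : realType) (C : cartanCurve R) (hC : bertrand12 C) :
  exists p : 'I_4 -> {poly R},
    [/\ forall (i : 'I_4) (s : R), cdom C s -> ccurve C s ord0 i = (p i).[s],
        forall i : 'I_4, (p i)^`(3) = 0
      & exists i : 'I_4, size (p i) = 3%N].
Proof.
have [s0 [_ [Is0 _ _]]] := cdom_nondegenerate C.
have cE := k1_eq0_quadratic Is0 (fun s => bertrand12_k1_eq0 hC).
have [[L0 _] _] := cLN_null Is0.
pose w i := cW1 C s0 ord0 i; pose l i := cL C s0 ord0 i / 2.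
(* Coefficients of the expansion at [s0], rearranged in powers of [s]. *)
pose e i := [:: ccurve C s0 ord0 i - w i * s0 + l i * s0 ^+ 2; w i - 2 * l i * s0; l i].
exists (fun i => \poly_(j < 3) (e i)`_j); split.
- move=> i s Is; rewrite cE// horner_poly !big_ord_recl big_ord0 /= -/(w i) -/(l i).
  by rewrite /bump /=; ring.
- by move=> i; apply: derivn_poly0; exact: size_poly.
(* The null vector [cL C s0] is nonzero by definition, and half of a nonzero coordinate of it is a
   leading coefficient; size 3 means degree two. *)
- have [i Li] : exists i, cL C s0 ord0 i != 0.
    apply/existsP; apply: contraNT L0 => /existsPn L0.
    by apply/eqP/rowP => i; rewrite mxE; apply/eqP; have := L0 i; rewrite negbK.
  exists i; apply: size_poly_eq => /=.
  by rewrite mulf_neq0// invr_eq0 pnatr_eq0.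
Qed.
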